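(* Let $V=W_1\oplus W_2$ be a finite-dimensional vector space over the non-archimedean field $F$, with $n_i=\dim W_i$ and $1\le n_1\leq n_2$, let $L=\mathrm{GL}(W_1)\times\mathrm{GL}(W_2)\subset\mathrm{GL}(V)$, and let $[\Lambda]$ be a vertex of the Euclidean building of $\mathrm{GL}(V)$. Then $$d_{\mathcal{A}}([\Lambda])=d_O\bigl(L[\Lambda],\overline{\mathcal{A}_{\mathcal{F}_1\cup\mathcal{F}_2}}\bigr),$$ where $d_{\mathcal{A}}([\Lambda])=\log_{\mathcal{P}}[\mathrm{Ann}(Q(\Lambda))]$.
   Context: $F$ is a non-archimedean field (with a discrete valuation and finite residue field), $\mathcal{O}$ its ring of integers, $\varpi$ a uniformizer, $\mathcal{P}=(\varpi)$, $\mathcal{P}^k=(\varpi^k)$, and $\log_{\mathcal{P}}(\mathcal{P}^k)=k$; $\mathbb{N}$ contains $0$. An $\mathcal{O}$-lattice in a finite-dimensional $F$-vector space is a finitely generated free $\mathcal{O}$-submodule spanning it over $F$; $[\Lambda]=\{a\Lambda : a\in F^\times\}$ is its homothety class. The vertices of the Euclidean building $\mathcal{B}_e\mathrm{GL}(V)$ are the homothety classes of lattices in $V$; $\mathrm{GL}(V)$, hence $L$, acts by $g[\Lambda]=[g\Lambda]$, and $L[\Lambda]$ is the $L$-orbit of $[\Lambda]$. Let $p_i:V\to W_i$ be the projections. For a lattice $\Lambda\subset V$ put $P_i(\Lambda)=p_i(\Lambda)$, $K_i(\Lambda)=\Lambda\cap W_i\subset P_i(\Lambda)$, and $Q_i(\Lambda)=P_i(\Lambda)/K_i(\Lambda)$.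 One has $Q_1(\Lambda)\cong Q_2(\Lambda)$; the common isomorphism class of $\mathcal{O}$-modules is denoted $Q(\Lambda)$ and depends only on $[\Lambda]$. $\mathrm{Ann}(Q(\Lambda))\subset\mathcal{O}$ is the annihilator ideal of this module. Let $A^{n}=\{(\alpha_i)_{i=1}^n\in\mathbb{N}^n : \alpha_i\geq\alpha_{i+1}\}$. The $L$-orbits of vertices are identified with $A^{n_1}$: the orbit $L[\Lambda]$ corresponds to the unique $\alpha\in A^{n_1}$ with $Q(\Lambda)\cong\bigoplus_{i=1}^{n_1}\mathcal{O}/\mathcal{P}^{\alpha_i}$. The orbital distance is $d_O(\alpha,\beta)=\max_{1\le i\le n_1}|\alpha_i-\beta_i|$, transported to orbits by this identification. A frame in an $m$-dimensional space is a set of $m$ linearly independent lines spanning it. For a frame $\mathcal{F}=\{l_1,\dots,l_m\}$ of $V$, the apartment $\mathcal{A}_{\mathcal{F}}$ has as vertices the classes $[\bigoplus_i\mathcal{O}v_i]$ with $0\neq v_i\in l_i$. Define $\overline{\mathcal{A}_{\mathcal{F}_1\cup\mathcal{F}_2}}=\bigcup\mathcal{A}_{\mathcal{F}_1\cup\mathcal{F}_2}$, the union over all frames $\mathcal{F}_1$ of $W_1$ and $\mathcal{F}_2$ of $W_2$. Its set of vertices is a single $L$-orbit, the one with $Q=0$, i.e. the one corresponding to $(0,\dots,0)\in A^{n_1}$; in $d_O(L[\Lambda],\overline{\mathcal{A}_{\mathcal{F}_1\cup\mathcal{F}_2}})$ the second argument denotes this orbit. *)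

(* Defs.v *)
From HB Require Import structures.
From mathcomp Require Import all_boot all_order all_algebra.
From mathcomp Require Import generic_quotient ring_quotient.
From mathcomp Require Import boolp classical_sets cardinality.

Set Implicit Arguments.
Unset Strict Implicit.
Unset Printing Implicit Defensive.

Import Order.TTheory GRing.Theory Num.Theory.
Local Open Scope ring_scope.

Section Modules.
Variable R : comNzRingType.

Section SubQuotient.
Variable M : lmodType R.

Definition submodule (S : submodClosed M) : Type := {x : M | x \in S}.

Variable S : submodClosed M.

HB.instance Definition _ := SubChoice.on (submodule S).
HB.instance Definition _ := [SubChoice_isSubLmodule of submodule S by <:].

Variable K : submodClosed M.

Definition relsub : {pred submodule S} := fun x => val x \in K.

Fact relsub_closed : submod_closed relsub.
Proof.
split=> [|a x y]; rewrite -!topredE /= /relsub; first by rewrite raddf0 rpred0.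
by move=> xK yK; rewrite linearP rpredD ?rpredZ.
Qed.

HB.instance Definition _ :=
  GRing.isSubmodClosed.Build R (submodule S) relsub relsub_closed.
End SubQuotient.

Section Quotient.
Variables (M : lmodType R) (K : submodClosed M).
Local Open Scope quotient_scope.

Definition zmod_of : {pred M} := mem K.

Fact zmod_of_closed : zmod_closed zmod_of.
Proof.
split=> [|x y]; first exact: (rpred0 K).
by move=> xK yK; rewrite -scaleN1r; apply: (rpredD xK); apply: rpredZ.
Qed.

HB.instance Definition _ := GRing.isZmodClosed.Build M zmod_of zmod_of_closed.

(* The carrier and its additive structure are those of ring_quotient; only the
   scaling is added. *)
Definition quotmod : Type := Quotient.quot zmod_of.

HB.instance Definition _ := GRing.Zmodule.on quotmod.
HB.instance Definition _ := EqQuotient.on quotmod.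

Definition quotmod_scale (a : R) (x : quotmod) : quotmod :=
  \pi_quotmod (a *: repr x).

Lemma quotmodP (x y : M) :
  (\pi_quotmod x = \pi_quotmod y) <-> (x - y \in K).
Proof.
rewrite -[_ \in _]/(Quotient.equiv zmod_of x y).
by split=> [/eqmodP|xy]; last apply/eqmodP.
Qed.

Lemma quotmod_piD (x y : M) :
  \pi_quotmod (x + y) = \pi_quotmod x + \pi_quotmod y.
Proof. exact: (raddfD (\pi_(Quotient.quot zmod_of))). Qed.

Lemma quotmod_piZ a (x : M) :
  \pi_quotmod (a *: x) = quotmod_scale a (\pi_quotmod x).
Proof.
by apply/quotmodP; rewrite -scalerBr rpredZ //; apply/quotmodP; rewrite reprK.
Qed.

Fact quotmod_scaleA a b x :
  quotmod_scale a (quotmod_scale b x) = quotmod_scale (a * b) x.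
Proof. by elim/quotW: x => x; rewrite -(quotmod_piZ b) -!quotmod_piZ scalerA. Qed.

Fact quotmod_scale1 : left_id 1 quotmod_scale.
Proof. by move=> x; rewrite /quotmod_scale scale1r reprK. Qed.

Fact quotmod_scaleDr : right_distributive quotmod_scale +%R.
Proof.
move=> a; elim/quotW=> x; elim/quotW=> y.
by rewrite -quotmod_piD -!quotmod_piZ -quotmod_piD scalerDr.
Qed.

Fact quotmod_scaleDl x : {morph quotmod_scale^~ x : a b / a + b}.
Proof. by move=> a b; rewrite /quotmod_scale -quotmod_piD scalerDl. Qed.

HB.instance Definition _ := GRing.Zmodule_isLmodule.Build R quotmod
  quotmod_scaleA quotmod_scale1 quotmod_scaleDr quotmod_scaleDl.
End Quotient.

Section DirectSum.
Variables (n : nat) (M : 'I_n -> lmodType R).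

Definition dirsum : Type := {dffun forall i : 'I_n, M i}.

HB.instance Definition _ := Choice.on dirsum.

Definition dirsum0 : dirsum := [ffun i => 0 : M i].
Definition dirsum_opp (x : dirsum) : dirsum := [ffun i => - x i].
Definition dirsum_add (x y : dirsum) : dirsum := [ffun i => x i + y i].
Definition dirsum_scale (a : R) (x : dirsum) : dirsum := [ffun i => a *: x i].

Fact dirsum_addA : associative dirsum_add.
Proof. by move=> x y z; apply/ffunP=> i; rewrite !ffunE addrA. Qed.
Fact dirsum_addC : commutative dirsum_add.
Proof. by move=> x y; apply/ffunP=> i; rewrite !ffunE addrC. Qed.
Fact dirsum_add0 : left_id dirsum0 dirsum_add.
Proof. by move=> x; apply/ffunP=> i; rewrite !ffunE add0r. Qed.
Fact dirsum_addN : left_inverse dirsum0 dirsum_opp dirsum_add.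
Proof. by move=> x; apply/ffunP=> i; rewrite !ffunE addNr. Qed.

HB.instance Definition _ := GRing.isZmodule.Build dirsum
  dirsum_addA dirsum_addC dirsum_add0 dirsum_addN.

Fact dirsum_scaleA a b x :
  dirsum_scale a (dirsum_scale b x) = dirsum_scale (a * b) x.
Proof. by apply/ffunP=> i; rewrite !ffunE scalerA. Qed.
Fact dirsum_scale1 : left_id 1 dirsum_scale.
Proof. by move=> x; apply/ffunP=> i; rewrite !ffunE scale1r. Qed.
Fact dirsum_scaleDr : right_distributive dirsum_scale +%R.
Proof. by move=> a x y; apply/ffunP=> i; rewrite !ffunE scalerDr. Qed.
Fact dirsum_scaleDl x : {morph dirsum_scale^~ x : a b / a + b}.
Proof. by move=> a b; apply/ffunP=> i; rewrite !ffunE scalerDl. Qed.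

HB.instance Definition _ := GRing.Zmodule_isLmodule.Build R dirsum
  dirsum_scaleA dirsum_scale1 dirsum_scaleDr dirsum_scaleDl.
End DirectSum.

Definition isomorphic (M N : lmodType R) : Prop :=
  exists f : {linear M -> N}, bijective f.

Lemma common_cover_isomorphic (A M N : lmodType R) (f : A -> M) (g : A -> N) :
    linear f -> linear g ->
    (forall y, exists x, f x = y) -> (forall y, exists x, g x = y) ->
    (forall x, f x = 0 <-> g x = 0) ->
  isomorphic M N.
Proof.
move=> fL gL fS gS fg.
pose fl : {linear A -> M} := HB.pack f (GRing.isLinear.Build R A M _ f fL).
pose gl : {linear A -> N} := HB.pack g (GRing.isLinear.Build R A N _ g gL).
have fgE x y : f x = f y <-> g x = g y.
  have := fg (x - y); rewrite -[f]/(fl : A -> M) -[g]/(gl : A -> N) !raddfB.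
  by case=> h k; split=> /eqP; rewrite -subr_eq0 => /eqP/[dup] + _;
    [move/h | move/k] => /eqP; rewrite subr_eq0 => /eqP.
pose s y := sval (cid (fS y)); pose t y := sval (cid (gS y)).
have sK y : f (s y) = y by exact: (svalP (cid (fS y))).
have tK y : g (t y) = y by exact: (svalP (cid (gS y))).
have hL : linear (g \o s).
  by move=> a x y /=; rewrite -gL; apply/fgE; rewrite fL !sK.
exists (HB.pack_for {linear M -> N} (g \o s)
          (GRing.isLinear.Build R M N _ (g \o s) hL)).
exists (f \o t) => x /=; first by rewrite -[RHS]sK; apply/fgE; rewrite tK.
by rewrite -[RHS]tK; apply/fgE; rewrite sK.
Qed.

Definition Ann (M : lmodType R) : set R :=
  [set a | forall x : M, a *: x = 0]%classic.

Definition principal (a : R) : {pred R^o} :=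
  fun x => `[< exists y : R, x = y * a >].

Fact principal_closed a : submod_closed (principal a).
Proof.
split=> [|b x y]; first by apply/asboolP; exists 0; rewrite mul0r.
move=> /asboolP[c ->] /asboolP[d ->]; apply/asboolP; exists (b * c + d).
by rewrite mulrDl -mulrA.
Qed.

HB.instance Definition _ a :=
  GRing.isSubmodClosed.Build R R^o (principal a) (principal_closed a).
End Modules.

Arguments relsub {R M} S K.

(* A normalised discrete valuation. The value at 0 carries no information: it
   stands for +oo, and every use below treats 0 separately. *)
Record discreteValuation (F : fieldType) := DiscreteValuation {
  dval :> F -> int;
  dvalM : forall x y, x != 0 -> y != 0 -> dval (x * y) = dval x + dval y;
  dvalD : forall x y, x != 0 -> y != 0 -> x + y != 0 ->
    Num.min (dval x) (dval y) <= dval (x + y);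
  dval_normal : exists2 x, x != 0 & dval x = 1
}.

Section Valuation.
Variables (F : fieldType) (v : discreteValuation F).

Definition integral : {pred F} := [pred x | (x == 0) || (0 <= v x)].

Lemma dval_one : v 1 = 0.
Proof.
have := dvalM v (oner_neq0 F) (oner_neq0 F).
by rewrite mulr1 -{1}[v 1]addr0 => /addrI.
Qed.

Lemma dvalN x : x != 0 -> v (- x) = v x.
Proof.
have N1 : (-1 : F) != 0 by rewrite oppr_eq0 oner_eq0.
move=> x0; rewrite -mulN1r dvalM //.
suff -> : v (-1) = 0 by rewrite add0r.
have /eqP := dvalM v N1 N1.
by rewrite mulrNN mulr1 dval_one eq_sym -mulr2n mulrn_eq0 => /eqP.
Qed.

Fact integral_subring : subring_closed integral.
Proof.
split=> [|x y|x y]; rewrite !inE.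
- by rewrite dval_one lexx orbT.
- have [->|x0] := eqVneq x 0 => /=.
    rewrite sub0r oppr_eq0 => _.
    by have [|y0] := eqVneq y 0 => //= ?; rewrite dvalN.
  have [->|y0] := eqVneq y 0 => /=; first by rewrite subr0 (negbTE x0).
  move=> vx vy; have [//|xy] := eqVneq (x - y) 0 => /=.
  have Ny : - y != 0 by rewrite oppr_eq0.
  by apply: le_trans (dvalD v x0 Ny xy); rewrite le_min vx dvalN.
- have [->|x0] := eqVneq x 0 => /=; first by rewrite mul0r eqxx.
  have [->|y0] := eqVneq y 0 => /=; first by rewrite mulr0 eqxx.
  by move=> vx vy; rewrite dvalM // addr_ge0 // orbT.
Qed.

HB.instance Definition _ :=
  GRing.isSubringClosed.Build F integral integral_subring.

Definition intring : Type := {x : F | x \in integral}.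

HB.instance Definition _ := SubChoice.on intring.
HB.instance Definition _ := [SubChoice_isSubComNzRing of intring by <:].

Definition uniformizer (varpi : intring) : Prop :=
  (val varpi != 0) /\ v (val varpi) = 1.

(* [idealP varpi k] is P^k = (varpi^k), and [resmod varpi k] is O / P^k. *)
Definition idealP (varpi : intring) (k : nat) : submodClosed intring^o :=
  principal (varpi ^+ k).

Definition resmod (varpi : intring) (k : nat) : lmodType intring :=
  quotmod (idealP varpi k).

Definition finite_residue_field (varpi : intring) : Prop :=
  finite_set [set: resmod varpi 1]%classic.

Definition logP (varpi : intring) (I : set intring) : nat :=
  xget 0%N [set k | I = [set x | x \in idealP varpi k]]%classic.

(* V with its scalars restricted from F to O. *)
Definition restr (V : lmodType F) : Type := V.

Section Restriction.
Variable V : lmodType F.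
HB.instance Definition _ := GRing.Zmodule.on (restr V).

Definition restr_scale (a : intring) (x : restr V) : restr V :=
  val a *: (x : V).

Fact restr_scaleA a b x :
  restr_scale a (restr_scale b x) = restr_scale (a * b) x.
Proof. by rewrite /restr_scale scalerA rmorphM. Qed.
Fact restr_scale1 : left_id 1 restr_scale.
Proof. by move=> x; rewrite /restr_scale rmorph1 scale1r. Qed.
Fact restr_scaleDr : right_distributive restr_scale +%R.
Proof. by move=> a x y; rewrite /restr_scale scalerDr. Qed.
Fact restr_scaleDl x : {morph restr_scale^~ x : a b / a + b}.
Proof. by move=> a b; rewrite /restr_scale rmorphD scalerDl. Qed.

HB.instance Definition _ := GRing.Zmodule_isLmodule.Build intring (restr V)
  restr_scaleA restr_scale1 restr_scaleDr restr_scaleDl.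
End Restriction.

Section Lattices.
Variable V : vectType F.

Definition intspan n (e : 'I_n -> V) : set V :=
  [set x | exists c : 'I_n -> intring, x = \sum_(i < n) val (c i) *: e i]%classic.

Definition intfree n (e : 'I_n -> V) : Prop :=
  forall c : 'I_n -> intring,
    \sum_(i < n) val (c i) *: e i = 0 -> forall i, c i = 0.

Record lattice := Lattice {
  lat_mod : submodClosed (restr V);
  lat_free : exists n (e : 'I_n -> V),
    intfree e /\ [set x : V | x \in lat_mod]%classic = intspan e;
  lat_span : forall U : {vspace V},
    (forall x : V, x \in lat_mod -> x \in U) -> U = fullv
}.

Definition lat_set (Lam : lattice) : set V :=
  [set x : V | x \in lat_mod Lam]%classic.

Definition homothety_class (A : set V) : set (set V) :=
  [set B | exists2 a : F, a != 0 & B = [set a *: x | x in A]]%classic.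

Definition vertex (Lam : lattice) : set (set V) :=
  homothety_class (lat_set Lam).

Definition act (g : 'End(V)) (X : set (set V)) : set (set V) :=
  [set [set g x | x in A] | A in X]%classic.

(* Frames are listed: a family of lines in direct sum has no repetition. *)
Definition is_frame (W : {vspace V}) (ls : seq {vspace V}) : Prop :=
  [/\ size ls = \dim W, all (fun l => \dim l == 1%N) ls,
      directv (\sum_(l <- ls) l)%VS & (\sum_(l <- ls) l)%VS = W].

Definition apartment (ls : seq {vspace V}) : set (set (set V)) :=
  [set X | exists e : 'I_(size ls) -> V,
     (forall i, e i != 0 /\ e i \in nth 0%VS ls i)
     /\ X = homothety_class (intspan e)]%classic.

Section Decomposition.
Variables W1 W2 : {vspace V}.

(* GL(W1) x GL(W2), embedded block-diagonally in GL(V). *)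
Definition Levi : set 'End(V) :=
  [set g | exists (g1 : 'End(subvs_of W1)) (g2 : 'End(subvs_of W2)),
     [/\ bijective g1, bijective g2 &
         forall x : V, g x = vsval (g1 (vsproj W1 (daddv_pi W1 W2 x)))
                           + vsval (g2 (vsproj W2 (daddv_pi W2 W1 x)))]]%classic.

Definition Lorbit (X : set (set V)) : set (set (set V)) :=
  [set act g X | g in Levi]%classic.

(* The vertices of the union of the apartments A_(F1 U F2). *)
Definition Abar : set (set (set V)) :=
  [set X | exists ls1 ls2 : seq {vspace V},
     [/\ is_frame W1 ls1, is_frame W2 ls2 & apartment (ls1 ++ ls2) X]]%classic.
End Decomposition.

Section Projections.
Local Open Scope quotient_scope.
(* W is the factor projected onto, along W'; P_1 is [projlat W1 W2] and P_2 is
   [projlat W2 W1]. *)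
Variables (W W' : {vspace V}) (Lam : lattice).

Definition projlat : {pred restr V} :=
  fun x => `[< exists2 y : V, y \in lat_mod Lam & x = daddv_pi W W' y >].

Fact projlat_closed : submod_closed projlat.
Proof.
split=> [|a x y].
  apply/asboolP; exists 0; first exact: (rpred0 (lat_mod Lam)).
  exact/esym/(linear0 (daddv_pi W W')).
move=> /asboolP[x' x'L ->] /asboolP[y' y'L ->]; apply/asboolP.
exists ((a *: (x' : restr V)) + y').
  exact: (rpredD (rpredZ a x'L) y'L).
exact/esym/(linearP (daddv_pi W W')).
Qed.

HB.instance Definition _ :=
  GRing.isSubmodClosed.Build intring (restr V) projlat projlat_closed.

Definition caplat : {pred restr V} :=
  fun x => (x \in lat_mod Lam) && ((x : V) \in W).

Fact caplat_closed : submod_closed caplat.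
Proof.
split=> [|a x y].
  by apply/andP; split; [exact: (rpred0 (lat_mod Lam)) | exact: mem0v].
move=> /andP[xL xW] /andP[yL yW]; apply/andP; split.
  exact: (rpredD (rpredZ a xL) yL).
exact: (memvD (memvZ (val a) xW) yW).
Qed.

HB.instance Definition _ :=
  GRing.isSubmodClosed.Build intring (restr V) caplat caplat_closed.

(* [relsub projlat caplat] is K_i viewed inside P_i. *)
Definition Qmod : lmodType intring := quotmod (relsub projlat caplat).

Definition lat_proj_Q (y : submodule (lat_mod Lam)) : Qmod :=
  \pi_(quotmod (relsub projlat caplat))
    (exist _ (daddv_pi W W' (val y) : restr V)
       (asboolT (ex_intro2 _ _ (val y : V) (valP y) erefl))
     : submodule projlat).

Lemma lat_proj_Q_linear : linear lat_proj_Q.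
Proof.
move=> a x y.
transitivity (quotmod_scale a (lat_proj_Q x) + lat_proj_Q y); last by [].
rewrite /lat_proj_Q -quotmod_piZ -quotmod_piD; congr (\pi_(_) _).
apply/val_inj => /=.
exact: (linearP (daddv_pi W W')).
Qed.

Lemma lat_proj_Q_surj z : exists y, lat_proj_Q y = z.
Proof.
elim/quotW: z => -[x xP]; have [y yL xE] := asboolW xP.
exists (exist _ (y : restr V) yL); congr (\pi_(_) _).
exact/val_inj/esym/xE.
Qed.

Lemma lat_proj_Q_eq0 (y : submodule (lat_mod Lam)) :
  lat_proj_Q y = 0 <-> (daddv_pi W W' (val y) : restr V) \in lat_mod Lam.
Proof.
have -> : (0 : Qmod) = \pi_(quotmod (relsub projlat caplat)) 0.
  by rewrite -[0 in RHS](scale0r 0) quotmod_piZ; apply/esym/scale0r.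
apply: (iff_trans (quotmodP _ _ _)); rewrite subr0.
apply: (iff_trans (B := caplat (daddv_pi W W' (val y)))); first by [].
by rewrite /caplat memv_pi andbT.
Qed.
End Projections.

Lemma Qmod_sym (W1 W2 : {vspace V}) (Lam : lattice) :
    (W1 + W2)%VS = fullv -> directv (W1 + W2) ->
  isomorphic (Qmod W1 W2 Lam) (Qmod W2 W1 Lam).
Proof.
move=> W12 dW12.
apply: (common_cover_isomorphic (@lat_proj_Q_linear W1 W2 Lam)
  (@lat_proj_Q_linear W2 W1 Lam)) => [y|y|x].
- exact: lat_proj_Q_surj.
- exact: lat_proj_Q_surj.
rewrite !lat_proj_Q_eq0; set x1 := daddv_pi W1 W2 _; set x2 := daddv_pi W2 W1 _.
have xE : (val x : V) = x1 + x2.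
  by rewrite daddv_pi_add ?W12 ?memvf //; apply/directv_addP.
split=> [x1L|x2L].
  have -> : x2 = (val x : V) - x1 by rewrite xE addrAC subrr add0r.
  exact: ((zmod_of_closed (lat_mod Lam)).2 _ _ (valP x) x1L).
have -> : x1 = (val x : V) - x2 by rewrite xE addrK.
exact: ((zmod_of_closed (lat_mod Lam)).2 _ _ (valP x) x2L).
Qed.

Section OrbitalDistance.
Variables (W1 W2 : {vspace V}) (varpi : intring).

(* Q(Lambda) is represented by Q_1(Lambda); see [Qmod_sym]. *)
Definition Q (Lam : lattice) : lmodType intring := Qmod W1 W2 Lam.

Definition dA (Lam : lattice) : nat := logP varpi (Ann (Q Lam)).

Definition dominant n (alpha : n.-tuple nat) : Prop :=
  sorted geq alpha.

(* The set of vertices S is an L-orbit and corresponds to alpha in A^(n_1),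
   n_1 = dim W1; in particular this fails if S is not a single L-orbit. *)
Definition orbit_type (S : set (set (set V))) (alpha : (\dim W1).-tuple nat) :
    Prop :=
  dominant alpha /\
  exists Lam : lattice, S = Lorbit W1 W2 (vertex Lam)
    /\ isomorphic (Q Lam) (dirsum (fun i => resmod varpi (tnth alpha i))).

Definition tuple_dist n (alpha beta : n.-tuple nat) : nat :=
  (\max_(i < n) `|(tnth alpha i)%:Z - (tnth beta i)%:Z|)%N.

Definition dO (S T : set (set (set V))) : nat :=
  xget 0%N [set d | exists alpha beta,
    [/\ orbit_type S alpha, orbit_type T beta & d = tuple_dist alpha beta]]%classic.
End OrbitalDistance.
End Lattices.
End Valuation.

(* Main.v *)
Require Import Defs.
From HB Require Import structures.
From mathcomp Require Import all_boot all_order all_algebra perm.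
From mathcomp Require Import generic_quotient.
From mathcomp Require Import boolp classical_sets cardinality.

(* Only the annihilator of Q(Lambda) matters. It is the set of a in O such that
   a p_1(Lambda) is contained in Lambda, which depends only on the L-orbit of
   [Lambda]. If Q(Lambda) is the sum of the O/P^(alpha_i), this annihilator is
   P^m with m = max alpha_i, so m is determined by the orbit; the orbit of the
   split lattices has Q = 0, so only alpha = 0 corresponds to it, and m is also
   the distance to it. That some alpha exists follows from the structure of
   finitely generated torsion O-modules: p_1(Lambda) needs at most n_1
   generators, because a dependent generator of a lattice can be dropped. *)

Set Implicit Arguments.
Unset Strict Implicit.
Unset Printing Implicit Defensive.

Import Order.TTheory GRing.Theory Num.Theory.
Local Open Scope ring_scope.

(** * Orders and powers of the uniformizer in the valuation ring *)

Section ValuationRing.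
Variables (F : fieldType) (v : discreteValuation F) (varpi : intring v).
Hypothesis varpiP : uniformizer varpi.

Lemma dvalX x n : x != 0 -> v (x ^+ n) = v x *+ n.
Proof.
move=> x0; elim: n => [|n IHn]; first by rewrite dval_one.
by rewrite exprS dvalM ?expf_neq0 // IHn mulrS.
Qed.

Lemma dvalV x : x != 0 -> v x^-1 = - v x.
Proof.
move=> x0; apply/eqP; rewrite -addr_eq0 addrC -dvalM ?invr_eq0 //.
by rewrite mulfV // dval_one.
Qed.

Lemma dval_uniformizerX n : v (val varpi ^+ n) = n.
Proof. by case: varpiP => w0 w1; rewrite dvalX // w1 natz. Qed.

Lemma integral_dval x : 0 <= v x -> x \in integral v.
Proof. by rewrite inE orbC => ->. Qed.

Lemma dval_intring_ge0 (a : intring v) : a != 0 -> 0 <= v (val a).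
Proof.
move=> a0; have := valP a; rewrite inE => /orP[/eqP a0'|//].
by case/eqP: a0; apply: val_inj.
Qed.

Definition to_intring (x : F) (xP : x \in integral v) : intring v :=
  exist (fun y => y \in integral v) x xP.

Lemma intring_val_neq0 (a : intring v) : (val a != 0) = (a != 0).
Proof. by rewrite -(inj_eq val_inj) rmorph0. Qed.

(** On nonzero integral elements the valuation is nonnegative, so the absolute value only moves it
    from [int] to [nat]. At 0 the number is meaningless, which is why [a = 0] is a separate case
    below. *)
Definition ord (a : intring v) : nat := `|v (val a)|%N.

Lemma intring_factor (a : intring v) k : a = 0 \/ (k <= ord a)%N ->
  exists u, a = u * varpi ^+ k.
Proof.
case=> [->|ka]; first by exists 0; rewrite mul0r.
have [->|a0] := eqVneq a 0; first by exists 0; rewrite mul0r.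
have [w0 w1] := varpiP; have a0' : val a != 0 by rewrite intring_val_neq0.
have uP : val a / val varpi ^+ k \in integral v.
  apply: integral_dval; rewrite dvalM ?invr_eq0 ?expf_neq0 //.
  rewrite dvalV ?expf_neq0 // dval_uniformizerX subr_ge0.
  by rewrite -(gez0_abs (dval_intring_ge0 a0)).
exists (to_intring uP); apply: val_inj.
by rewrite rmorphM rmorphXn /= divfK // expf_neq0.
Qed.

Lemma unit_of_ord0 (u : intring v) : u != 0 -> ord u = 0%N ->
  exists w, w * u = 1.
Proof.
move=> u0 ou; have u0' : val u != 0 by rewrite intring_val_neq0.
have wP : (val u)^-1 \in integral v.
  apply: integral_dval; rewrite dvalV //.
  by move/eqP: ou; rewrite absz_eq0 => /eqP->; rewrite oppr0.
by exists (to_intring wP); apply: val_inj; rewrite rmorphM rmorph1 /= mulVf.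
Qed.

Lemma ordM (a b : intring v) : a != 0 -> b != 0 -> ord (a * b) = (ord a + ord b)%N.
Proof.
move=> a0 b0; apply/eqP; rewrite -eqz_nat PoszD /ord.
have a0' : val a != 0 by rewrite intring_val_neq0.
have b0' : val b != 0 by rewrite intring_val_neq0.
rewrite rmorphM dvalM // !gez0_abs ?addr_ge0 //; exact: dval_intring_ge0.
Qed.

Lemma uniformizerX_neq0 k : varpi ^+ k != 0.
Proof.
by have [w0 _] := varpiP; rewrite -intring_val_neq0 rmorphXn expf_neq0.
Qed.

Lemma ord_uniformizerX k : ord (varpi ^+ k) = k.
Proof. by rewrite /ord rmorphXn dval_uniformizerX. Qed.

Lemma mem_idealP k (a : intring v) :
  a \in idealP varpi k <-> exists u, a = u * varpi ^+ k.
Proof. by split=> [/asboolP|?]; last apply/asboolP. Qed.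

Lemma mem_idealP_ord k (a : intring v) :
  a \in idealP varpi k <-> a = 0 \/ (k <= ord a)%N.
Proof.
split=> [/mem_idealP[u ->]|/intring_factor/mem_idealP //].
have [->|u0] := eqVneq u 0; first by left; rewrite mul0r.
by right; rewrite ordM ?uniformizerX_neq0 // ord_uniformizerX leq_addl.
Qed.

Lemma idealP_sub k l : varpi ^+ k \in idealP varpi l <-> (l <= k)%N.
Proof.
split=> [/mem_idealP_ord[/eqP|]|lk].
- by rewrite (negPf (uniformizerX_neq0 k)).
- by rewrite ord_uniformizerX.
by apply/mem_idealP_ord; right; rewrite ord_uniformizerX.
Qed.

(** The powers of P form a strictly decreasing chain, so the exponent picked by [xget] is unique and
    its default value does not arise. *)
Lemma logP_idealP k :
  logP varpi [set x | x \in idealP varpi k]%classic = k.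
Proof.
apply: xget_unique => // l /seteqP[kl lk]; apply/eqP; rewrite eqn_leq.
apply/andP; split; apply/idealP_sub; [apply: kl | apply: lk];
  exact/idealP_sub.
Qed.

Lemma clear_denominator (x : F) :
  exists k, (val varpi) ^+ k * x \in integral v.
Proof.
have [w0 w1] := varpiP.
have [->|x0] := eqVneq x 0; first by exists 0%N; rewrite mulr0 inE eqxx.
(* This exponent works for both signs of the valuation, since [v x + |v x| >= 0]. *)
exists `|v x|%N; apply: integral_dval.
rewrite dvalM ?expf_neq0 // dval_uniformizerX -lerBlDr sub0r abszE -normrN.
exact: ler_norm.
Qed.

(** * Finitely generated torsion modules over O *)

Section TorsionModules.
Variable M : lmodType (intring v).

Definition generates n (x : 'I_n -> M) : Prop :=
  forall m, exists c : 'I_n -> intring v, m = \sum_(i < n) c i *: x i.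

(** As [w] inverts [d i0], the old generator [x i0] is [w] times the new element minus a combination
    of the other generators; the witness substitutes this into [c]. *)
Lemma exchange_generator n (x : 'I_n -> M) (d : 'I_n -> intring v) w i0 :
    generates x -> w * d i0 = 1 ->
  generates (fun i => if i == i0 then \sum_(j < n) d j *: x j else x i).
Proof.
move=> xg wd m; have [c ->] := xg m.
exists (fun i => if i == i0 then c i0 * w else c i - c i0 * w * d i).
rewrite [RHS](bigD1 i0) //= !eqxx [in LHS](bigD1 i0) //= [in RHS](bigD1 i0) //=.
rewrite scalerDr scalerA -mulrA wd mulr1 -addrA; congr (_ + _).
rewrite scaler_sumr -big_split; apply: eq_bigr => i /negPf -> /=.
by rewrite scalerBl scalerA addrCA subrr addr0.
Qed.

(* A relation [\sum c i *: x i = 0] with a nonzero term, divided by its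
   coefficient of least order b, gives an element killed by varpi ^+ b. It can
   replace the corresponding generator, which lowers the sum of the exponents;
   a family with no such relation decomposes the module. *)
Lemma torsion_generators n (x : 'I_n -> M) (a : 'I_n -> nat) :
    generates x -> (forall i, varpi ^+ a i *: x i = 0) ->
  exists (y : 'I_n -> M) (b : 'I_n -> nat), generates y /\
    forall c : 'I_n -> intring v,
      \sum_(i < n) c i *: y i = 0 <-> forall i, c i \in idealP varpi (b i).
Proof.
move sE: (\sum_(i < n) a i)%N => s.
elim/ltn_ind: s a x sE => s IHs a x sE xg ax.
have killed i c : c \in idealP varpi (a i) -> c *: x i = 0.
  by move=> /mem_idealP[u ->]; rewrite -scalerA ax scaler0.
have [bad|] := pselect (exists c : 'I_n -> intring v,
   \sum_(i < n) c i *: x i = 0 /\ exists i, c i \notin idealP varpi (a i)).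
  have [c [cx [i1 ci1]]] := bad.
  (* Coefficients in P^(a i) act as zero; without them every remaining coefficient has order at
     least that of [c i0], chosen next. *)
  pose c' i := if c i \in idealP varpi (a i) then 0 else c i.
  case: (@arg_minnP _ i1 (fun i => c i \notin idealP varpi (a i))
    (ord \o c) ci1) => /= i0 ci0 i0min.
  have c'x : \sum_(i < n) c' i *: x i = 0.
    rewrite -[RHS]cx; apply: eq_bigr => i _; rewrite /c'.
    by case: ifP => // /killed ->; rewrite scale0r.
  have /choice[d dE] i : exists u, c' i = u * varpi ^+ ord (c i0).
    apply: intring_factor; rewrite /c'; case: ifPn => [_|/i0min]; first by left.
    by right.
  have c0 : c i0 != 0 by apply: contraNneq ci0 => ->; rewrite rpred0.
  have dE0 : c i0 = d i0 * varpi ^+ ord (c i0) by rewrite -dE /c' (negPf ci0).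
  have d0 : d i0 != 0 by apply: contraNneq c0 => d0; rewrite dE0 d0 mul0r.
  (* Comparing orders in [c i0 = d i0 * varpi ^+ ord (c i0)] shows that [d i0] is a unit. *)
  have [|w wd] := @unit_of_ord0 (d i0) d0.
    move: (congr1 ord dE0); rewrite ordM ?uniformizerX_neq0 //.
    by rewrite ord_uniformizerX -[LHS]add0n => /addIn.
  have lt0 : (ord (c i0) < a i0)%N.
    rewrite ltnNge; apply: contra ci0 => le0.
    by apply/mem_idealP_ord; right.
  apply: (IHs (\sum_(i < n) if i == i0 then ord (c i0) else a i)%N _
    (fun i => if i == i0 then ord (c i0) else a i) _ erefl
    (exchange_generator xg wd)).
    rewrite -sE (bigD1 i0) //= eqxx [X in (_ < X)%N](bigD1 i0) //=.
    by rewrite -addSn leq_add //; apply/eq_leq/eq_bigr => i /negPf->.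
  (* Multiplying the new generator by the power that was divided out gives back the relation
     [c']. *)
  move=> i; case: eqP => // _; rewrite scaler_sumr -[RHS]c'x.
  by apply: eq_bigr => j _; rewrite scalerA dE mulrC.
move=> nobad; exists x, a; split=> // c; split=> [cx i|ca].
  by apply: contrapT => /negP ci; apply: nobad; exists c; split=> //; exists i.
by apply: big1 => i _; apply: killed.
Qed.

End TorsionModules.

End ValuationRing.

(** * Annihilators of quotients, and direct sums of the O/P^k *)

Lemma quotmod_pi_eq0 (R : comNzRingType) (M : lmodType R) (K : submodClosed M)
    (x : M) :
  (\pi_(quotmod K) x)%qT = 0 <-> x \in K.
Proof.
have -> : (0 : quotmod K) = (\pi_(quotmod K) 0)%qT.
  by rewrite -[0 in RHS](scale0r 0) quotmod_piZ; apply/esym/scale0r.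
by apply: iff_trans (quotmodP _ _ _) _; rewrite subr0.
Qed.

Lemma Ann_isomorphic (R : comNzRingType) (M N : lmodType R) :
  isomorphic M N -> Ann M = Ann N.
Proof.
move=> [f [g fK gK]]; apply/seteqP; split=> a aM x.
  by rewrite -[x]gK -linearZZ (aM _) linear0.
by apply: (can_inj fK); rewrite linearZZ linear0 (aM _).
Qed.

Section ResidueModules.
Variables (F : fieldType) (v : discreteValuation F) (varpi : intring v).
Hypothesis varpiP : uniformizer varpi.

Lemma Ann_dirsum_resmod n (alpha : 'I_n -> nat) :
  Ann (dirsum (fun i => resmod varpi (alpha i))) =
  [set a | a \in idealP varpi (\max_(i < n) alpha i)]%classic.
Proof.
apply/seteqP; split=> a /= aP.
  have aPi i : a \in idealP varpi (alpha i).
    apply/quotmod_pi_eq0.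
    (* The vector of the classes of 1 tests all summands at once. *)
    pose e : dirsum (fun i => resmod varpi (alpha i)) :=
      [ffun i => (\pi_(resmod varpi (alpha i)) 1)%qT].
    move: (aP e) => /(congr1 (fun z : dirsum (fun i => resmod varpi (alpha i)) => z i)).
    rewrite !ffunE => <-; rewrite -[a in LHS]mulr1; exact: quotmod_piZ.
  have [->|a0] := eqVneq a 0; first exact: rpred0.
  apply/(mem_idealP_ord varpiP); right; apply/bigmax_leqP => i _.
  by case/(mem_idealP_ord varpiP): (aPi i) => // /eqP; rewrite (negPf a0).
move=> x; apply/ffunP => i; rewrite !ffunE.
elim/quotW: (x i) => z; rewrite -[LHS]quotmod_piZ; apply/quotmod_pi_eq0.
apply/(mem_idealP_ord varpiP).
case/(mem_idealP_ord varpiP): aP => [->|aP]; first by left; rewrite scale0r.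
have [->|z0] := eqVneq z 0; first by left; rewrite scaler0.
have [->|a0] := eqVneq a 0; first by left; rewrite scale0r.
right; rewrite [_ *: _]/(a * z) (ordM a0 z0).
by apply: leq_trans (leq_addr _ _); apply: leq_trans aP; apply: leq_bigmax.
Qed.

(** Both modules are quotients of O^n by the same product of the ideals P^(alpha_i). Sorting makes
    the exponents dominant, and the permutation [p] records which generator each sorted exponent
    belongs to. *)
Lemma torsion_isomorphic (M : lmodType (intring v)) n (x : 'I_n -> M)
    (a : 'I_n -> nat) :
    generates x -> (forall i, varpi ^+ a i *: x i = 0) ->
  exists alpha : n.-tuple nat, dominant alpha /\
    isomorphic M (dirsum (fun i => resmod varpi (tnth alpha i))).
Proof.
move=> xg ax; have [y [b [yg yb]]] := torsion_generators varpiP xg ax.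
pose alpha := [tuple of sort geq [tuple b i | i < n]].
have /tuple_permP[p pE] : perm_eq alpha [tuple b i | i < n].
  exact/permPl/perm_sort.
have alphaE i : tnth alpha i = b (p i).
  have -> : alpha = [tuple tnth [tuple b i | i < n] (p i) | i < n].
    exact: val_inj.
  by rewrite !tnth_mktuple.
exists alpha; split.
  by apply: sort_sorted => i j; rewrite /geq /=; exact: leq_total.
pose A : lmodType (intring v) := {ffun 'I_n -> (intring v)^o}.
pose f (c : A) := \sum_(i < n) (c i : intring v) *: y (p i).
pose g (c : A) : dirsum (fun i => resmod varpi (tnth alpha i)) :=
  [ffun i => (\pi_(resmod varpi (tnth alpha i)) (c i))%qT].
apply: (@common_cover_isomorphic _ A _ _ f g).
- move=> k c d; rewrite /f scaler_sumr -big_split; apply: eq_bigr => i _.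
  by rewrite !ffunE scalerDl -scalerA.
- move=> k c d; apply/ffunP => i; rewrite !ffunE.
  by rewrite quotmod_piD quotmod_piZ.
- move=> m; have [c ->] := yg m; exists [ffun i => c (p i)].
  rewrite [RHS](reindex_inj (@perm_inj _ p)) /=.
  by apply: eq_bigr => i _; rewrite ffunE.
- move=> z; exists [ffun i => repr (z i)].
  by apply/ffunP => i; rewrite !ffunE reprK.
move=> c; have -> : f c = \sum_(i < n) c ((p^-1)%g i) *: y i.
  rewrite [RHS](reindex_inj (@perm_inj _ p)) /=.
  by apply: eq_bigr => i _; rewrite permK.
apply: iff_trans (yb _) _; split=> [cb|gc i].
  apply/ffunP => i; rewrite !ffunE; apply/quotmod_pi_eq0.
  by rewrite alphaE; have := cb (p i); rewrite permK.
have := congr1 (fun z : dirsum (fun i => resmod varpi (tnth alpha i)) =>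
  z ((p^-1)%g i)) gc.
by rewrite !ffunE => /quotmod_pi_eq0; rewrite alphaE permKV.
Qed.

End ResidueModules.

(** * The quotient Q(Lambda): its annihilator and its decomposition *)

Section LatticeQuotient.
Variables (F : fieldType) (v : discreteValuation F) (varpi : intring v).
Hypothesis varpiP : uniformizer varpi.
Variable V : vectType F.
Implicit Types (W : {vspace V}) (Lam : lattice v V).

HB.instance Definition _ W W' Lam :=
  GRing.isLinear.Build (intring v) (submodule (lat_mod Lam)) (Qmod W W' Lam) _
    (@lat_proj_Q F v V W W' Lam) (@lat_proj_Q_linear F v V W W' Lam).

Definition in_lat Lam (y : V) (yL : (y : restr V) \in lat_mod Lam) :
  submodule (lat_mod Lam) := exist (fun z => z \in lat_mod Lam) y yL.

(** The map from the lattice to Q is onto, and its kernel consists of the vectors whose projection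
    stays in the lattice. This form of the condition can be transported along an orbit. *)
Lemma Ann_QP W1 W2 Lam (a : intring v) :
  Ann (Q W1 W2 Lam) a <-> forall y : V, (y : restr V) \in lat_mod Lam ->
    (val a *: daddv_pi W1 W2 y : restr V) \in lat_mod Lam.
Proof.
split=> [aQ y yL|aL z].
  have := aQ (lat_proj_Q W1 W2 (in_lat yL)).
  rewrite -linearZZ => /lat_proj_Q_eq0 /=.
  by rewrite /restr_scale linearZ.
have [[y yL] <-] := lat_proj_Q_surj z; rewrite -linearZZ.
apply/lat_proj_Q_eq0 => /=; have := aL y yL.
by rewrite -linearZ.
Qed.

(** Generators of the lattice span [V] over F, so only the finitely many denominators of the
    coordinates of [x] have to be cleared. *)
Lemma lattice_torsion Lam (x : V) :
  exists k, ((val varpi ^+ k *: x : V) : restr V) \in lat_mod Lam.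
Proof.
have [n [e [_ eL]]] := lat_free Lam.
have sE : <<[tuple e i | i < n]>>%VS = fullv.
  apply: (@lat_span _ _ _ Lam) => y yL; have : intspan v e y by rewrite -eL.
  move=> [c ->]; apply: memv_suml => i _; apply: memvZ; apply: memv_span.
  by rewrite -[e i](tnth_mktuple e); apply: mem_tnth.
have xs : x \in <<[tuple e i | i < n]>>%VS by rewrite sE memvf.
have /choice[k kP] i := clear_denominator varpiP (coord [tuple e i | i < n] i x).
(* The sum is a common exponent: [k i] clears the denominator at [i], and the rest is an integral
   factor. *)
exists (\sum_(i < n) k i)%N.
suff : intspan v e (val varpi ^+ (\sum_(i < n) k i)%N *: x) by rewrite -eL.
have /choice[c cE] i : exists c : intring v,
    val c = val varpi ^+ (\sum_(i < n) k i)%N * coord [tuple e i | i < n] i x.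
  exists (varpi ^+ (\sum_(j < n | j != i) k j)%N * to_intring (kP i)).
  by rewrite rmorphM rmorphXn /= mulrA -exprD [in RHS](bigD1 i) //= addnC.
exists c; rewrite {1}(coord_span xs) scaler_sumr; apply: eq_bigr => i _.
by rewrite cE scalerA -tnth_nth tnth_mktuple.
Qed.

(** Dividing the relation by a nonzero coefficient of least valuation makes all the other
    coefficients integral. *)
Lemma dependent_generator n (e : 'I_n.+1 -> V) (d : 'I_n.+1 -> F) i1 :
    d i1 != 0 -> \sum_(i < n.+1) d i *: e i = 0 ->
  exists (i0 : 'I_n.+1) (c : 'I_n -> intring v),
    e i0 = \sum_(j < n) val (c j) *: e (lift i0 j).
Proof.
move=> d1 de.
have [i0 d0 i0min] : exists2 i0, d i0 != 0 &
    forall i, d i != 0 -> v (d i0) <= v (d i).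
  case: (@Order.TotalTheory.arg_minP _ _ _ i1 (fun i => d i != 0)
    (fun i => v (d i)) d1) => i0 d0 i0min.
  by exists i0.
have /choice[c cE] i : exists c : intring v, val c = - (d i / d i0).
  have cP : - (d i / d i0) \in integral v.
    rewrite rpredN; have [->|di] := eqVneq (d i) 0; first by rewrite mul0r rpred0.
    apply: integral_dval; rewrite dvalM ?invr_eq0 // dvalV // subr_ge0.
    exact: i0min.
  by exists (to_intring cP).
exists i0, (c \o lift i0); apply: (scalerI d0); move/eqP: de.
rewrite (bigD1_ord i0) //= addr_eq0 => /eqP->; rewrite -sumrN scaler_sumr.
apply: eq_bigr => i _; rewrite cE scalerA mulrN mulrCA mulfV // mulr1.
by rewrite scaleNr.
Qed.

Lemma intspan_dim W n (e : 'I_n -> V) : (forall i, e i \in W) ->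
  exists e' : 'I_(\dim W) -> V, intspan v e' = intspan v e.
Proof.
elim: n e => [|n IHn] e eW.
  exists (fun _ => 0); apply/seteqP; split=> x /= [c ->].
    exists (fun _ => 0); rewrite [RHS]big_ord0.
    by apply: big1 => i _; rewrite scaler0.
  exists (fun _ => 0); rewrite [LHS]big_ord0.
  by apply/esym/big1 => i _; rewrite scaler0.
have [le_nW|lt_Wn] := leqP n.+1 (\dim W).
  rewrite -(subnKC le_nW); move: (_ - _)%N => k.
  exists (fun i => match split i with inl j => e j | inr _ => 0 end).
  apply/seteqP; split=> x /= [c ->].
    exists (fun i => c (lshift k i)); rewrite big_split_ord /=.
    rewrite [X in _ + X]big1 ?addr0 => [|i _].
      by apply: eq_bigr => i _; rewrite (unsplitK (inl i)).
    by rewrite (unsplitK (inr i)) scaler0.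
  exists (fun i => match split i with inl j => c j | inr _ => 0 end).
  rewrite big_split_ord /= [X in _ = _ + X]big1 ?addr0 => [|i _].
    by apply: eq_bigr => i _; rewrite (unsplitK (inl i)).
  by rewrite (unsplitK (inr i)) scaler0.
have [d [de [i1 d1]]] : exists d : 'I_n.+1 -> F,
    \sum_(i < n.+1) d i *: e i = 0 /\ exists i1, d i1 != 0.
  apply: contrapT => nod.
  suff /eqP : free [tuple e i | i < n.+1].
    move: lt_Wn; rewrite size_tuple ltnNge => /negP lt_Wn eqn; apply: lt_Wn.
    rewrite -eqn; apply/dimvS/span_subvP => _ /mapP[i _ ->]; exact: eW.
  apply/freeP => d de i; apply: contrapT => /eqP di; apply: nod; exists d.
  split; last by exists i.
  by rewrite -[RHS]de; apply: eq_bigr => j _; rewrite -tnth_nth tnth_mktuple.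
have [i0 [c cE]] := dependent_generator d1 de.
have [e' e'E] := IHn (e \o lift i0) (fun i => eW _).
exists e'; rewrite e'E; apply/seteqP; split=> x /= [b ->].
  exists (fun i => if unlift i0 i is Some j then b j else 0).
  rewrite (bigD1_ord i0) //= unlift_none scale0r add0r.
  by apply: eq_bigr => j _; rewrite liftK.
exists (fun i => b i0 * c i + b (lift i0 i)).
rewrite (bigD1_ord i0) //= {1}cE scaler_sumr -big_split.
by apply: eq_bigr => i _ /=; rewrite scalerDl scalerA.
Qed.

Lemma Q_type W1 W2 Lam :
  exists alpha : (\dim W1).-tuple nat, dominant alpha /\
    isomorphic (Q W1 W2 Lam) (dirsum (fun i => resmod varpi (tnth alpha i))).
Proof.
have [n [e [_ eL]]] := lat_free Lam.
have [x xE] := @intspan_dim W1 n (daddv_pi W1 W2 \o e)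
  (fun i => memv_pi _ _ _).
have projE y (c : 'I_n -> intring v) : y = \sum_(i < n) val (c i) *: e i ->
    daddv_pi W1 W2 y = \sum_(i < n) val (c i) *: daddv_pi W1 W2 (e i).
  by move=> ->; rewrite linear_sum; apply: eq_bigr => i _; rewrite linearZ.
have latE y : (y : restr V) \in lat_mod Lam <-> intspan v e y by rewrite -eL.
(* Each of the [\dim W1] generators of the projected lattice lifts to the lattice; the classes of
   the lifts will generate Q. *)
have /choice[y yP] i : exists y : submodule (lat_mod Lam),
    daddv_pi W1 W2 (val y) = x i.
  have : intspan v x (x i).
    exists (fun j => if j == i then 1 else 0).
    rewrite (bigD1 i) //= eqxx scale1r big1 ?addr0 // => j /negPf->.
    by rewrite scale0r.
  rewrite xE => -[c ->].
  have yL : intspan v e (\sum_(i < n) val (c i) *: e i) by exists c.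
  by exists (in_lat ((latE _).2 yL)); rewrite /= (projE _ c).
have /choice[k kP] i := lattice_torsion Lam (x i).
apply: (torsion_isomorphic varpiP (x := fun i => lat_proj_Q W1 W2 (y i)) (a := k)).
- move=> m; have [[z zL] <-] := lat_proj_Q_surj m.
  have [c cE] := (latE _).1 zL.
  have : intspan v x (daddv_pi W1 W2 z) by rewrite xE; exists c; apply: projE.
  move=> [b bE]; exists b; apply/eqP; rewrite -subr_eq0; apply/eqP.
  under eq_bigr => i _ do rewrite -linearZZ.
  rewrite -linear_sum -linearB; apply/lat_proj_Q_eq0.
  (* [z] and the combination of lifts have the same projection, so their difference becomes zero in
     Q. *)
  have -> : daddv_pi W1 W2
      (val (in_lat zL - \sum_(i < \dim W1) b i *: y i) : V) = 0.
    rewrite (raddfB val) (raddf_sum val) (linearB (daddv_pi W1 W2)).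
    rewrite /= bE (linear_sum (daddv_pi W1 W2)) -sumrB.
    apply: big1 => i _; rewrite -yP -linearZ; exact: subrr.
  exact: rpred0.
move=> i; rewrite -linearZZ; apply/lat_proj_Q_eq0.
have -> : val (varpi ^+ k i *: y i) = val varpi ^+ k i *: (val (y i) : V) :> V.
  by rewrite -rmorphXn.
by have := kP i; rewrite -(yP i) -linearZ.
Qed.

End LatticeQuotient.

(** * Linear maps acting on homothety classes and on spans of bases *)

Section LeviOrbits.
Variables (F : fieldType) (v : discreteValuation F) (V : vectType F).
Implicit Types (g : 'End(V)) (A : set V) (Lam : lattice v V) (s : seq V).

Lemma act_homothety_class g A :
  act g (homothety_class A) = homothety_class [set g x | x in A]%classic.
Proof.
have gZ a : [set g x | x in [set a *: x | x in A]]%classic =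
            [set a *: x | x in [set g x | x in A]]%classic.
  by rewrite !image_comp; apply/eq_imagel => x _ /=; rewrite linearZ.
apply/seteqP; split=> [_ [_ [a a0 ->] <-]|_ [a a0 ->]]; first by exists a.
by rewrite -gZ; exists [set a *: x | x in A]%classic => //; exists a.
Qed.

Lemma mem_homothety_class A : homothety_class A A.
Proof.
exists 1; rewrite ?oner_neq0 //; apply/seteqP; split=> [x Ax|_ [x Ax <-]].
  by exists x => //; rewrite scale1r.
by rewrite scale1r.
Qed.

(** Indexing by a sequence lets bases of the two summands be concatenated and mapped without casts
    between ordinal types. *)
Definition intspan_seq s : set V := intspan v (fun i : 'I_(size s) => s`_i).

Lemma intspan_size n s (e : 'I_n -> V) :
  size s = n -> (forall i : 'I_n, s`_i = e i) -> intspan v e = intspan_seq s.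
Proof.
move=> sn; case: n / sn e => e se; rewrite /intspan_seq.
by congr intspan; apply/funext => i; rewrite se.
Qed.

Lemma image_intspan_seq g s :
  [set g x | x in intspan_seq s]%classic = intspan_seq (map g s).
Proof.
have <- : intspan v (fun i : 'I_(size s) => g s`_i) = intspan_seq (map g s).
  by apply: intspan_size => [|i]; rewrite ?size_map // (nth_map 0).
apply/seteqP; split=> [_ [_ [c ->] <-]|_ [c ->]].
  by exists c; rewrite linear_sum; apply: eq_bigr => i _; rewrite linearZ.
exists (\sum_(i < size s) val (c i) *: s`_i); first by exists c.
by rewrite linear_sum; apply: eq_bigr => i _; rewrite linearZ.
Qed.

(** The boolean form of [intspan], able to carry the submodule structure that [lattice] requires. *)
Definition in_intspan n (e : 'I_n -> V) : {pred restr V} :=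
  fun x => `[< intspan v e x >].

Fact in_intspan_closed n (e : 'I_n -> V) :
  @GRing.submod_closed (intring v) (restr V) (in_intspan e).
Proof.
split=> [|a x y].
  apply/asboolP; exists (fun _ => 0); apply/esym/big1 => i _.
  by rewrite scale0r.
move=> /asboolP[c ->] /asboolP[d ->]; apply/asboolP.
exists (fun i => a * c i + d i); rewrite /= [_ *: _]scaler_sumr -big_split.
by apply: eq_bigr => i _ /=; rewrite scalerDl scalerA.
Qed.

HB.instance Definition _ n (e : 'I_n -> V) :=
  GRing.isSubmodClosed.Build (intring v) (restr V) (in_intspan e)
    (in_intspan_closed e).

Lemma basis_lattice s : basis_of fullv s ->
  exists Lam, lat_set Lam = intspan_seq s.
Proof.
move=> sb.
pose e (i : 'I_(size s)) := s`_i.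
pose S : submodClosed (restr V) := in_intspan e.
have SE : [set x : V | x \in S]%classic = intspan v e.
  by apply/seteqP; split=> x /asboolP.
have S_free : exists n (e : 'I_n -> V),
    intfree v e /\ [set x : V | x \in S]%classic = intspan v e.
  exists (size s), e; split=> // c ce i; apply: val_inj.
  have /freeP s_free : free (in_tuple s) := basis_free sb.
  by rewrite rmorph0 (s_free (fun i => val (c i))).
have S_span (U : {vspace V}) : (forall x : V, x \in S -> x \in U) -> U = fullv.
  move=> SU; apply/eqP; rewrite eqEsubv subvf -(span_basis sb).
  apply/span_subvP => x xs; apply/SU/asboolP.
  have xi : (index x s < size s)%N by rewrite index_mem.
  exists (fun j => if j == Ordinal xi then 1 else 0).
  rewrite (bigD1 (Ordinal xi)) //= eqxx scale1r /e nth_index // big1 ?addr0 //.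
  by move=> j /negPf->; rewrite scale0r.
by exists (Lattice S_free S_span).
Qed.

(** * The group L and bases adapted to the decomposition *)

Variables W1 W2 : {vspace V}.
Hypotheses (W12 : (W1 + W2)%VS = fullv) (dW12 : directv (W1 + W2)).

Let capW12 : (W1 :&: W2 = 0)%VS. Proof. exact/directv_addP. Qed.
Let capW21 : (W2 :&: W1 = 0)%VS. Proof. by rewrite capvC. Qed.

Lemma daddv_pi_sum x : daddv_pi W1 W2 x + daddv_pi W2 W1 x = x.
Proof. by rewrite daddv_pi_add // W12 memvf. Qed.

Lemma daddv_pi1_eq0 x : x \in W2 -> daddv_pi W1 W2 x = 0.
Proof.
by move=> xW; apply: (addIr x); rewrite -{2}(daddv_pi_id capW21 xW)
  daddv_pi_sum add0r.
Qed.

Lemma daddv_pi2_eq0 x : x \in W1 -> daddv_pi W2 W1 x = 0.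
Proof.
by move=> xW; apply: (addrI x); rewrite -{1}(daddv_pi_id capW12 xW)
  daddv_pi_sum addr0.
Qed.

(** The block form is replaced by stability of both summands. In finite dimension injectivity gives
    invertibility, for [g] and for its restrictions alike. *)
Lemma LeviP g : Levi W1 W2 g <->
  [/\ lker g == 0%VS, (g @: W1 <= W1)%VS & (g @: W2 <= W2)%VS].
Proof.
split=> [[g1 [g2 [g1b g2b gE]]]|[g0 gW1 gW2]].
  split.
  - rewrite -subv0; apply/subvP => x; rewrite memv_ker memv0 gE => /eqP gx0.
    have /eqP := gx0; rewrite addr_eq0 => /eqP g12.
    (* The two components of [g x = 0] are opposite, hence lie in the zero intersection of [W1] and
       [W2]. *)
    have g1x : vsval (g1 (vsproj W1 (daddv_pi W1 W2 x))) = 0.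
      apply/eqP; rewrite -memv0 -capW12 memv_cap subvsP /=.
      by rewrite g12 memvN subvsP.
    have g2x : vsval (g2 (vsproj W2 (daddv_pi W2 W1 x))) = 0.
      by rewrite -[LHS]add0r -{1}g1x gx0.
    have p1 : daddv_pi W1 W2 x = 0.
      rewrite -(vsprojK (memv_pi W1 W2 x)) (_ : vsproj _ _ = 0) ?linear0 //.
      by apply: (bij_inj g1b); apply: val_inj; rewrite /= g1x !linear0.
    have p2 : daddv_pi W2 W1 x = 0.
      rewrite -(vsprojK (memv_pi W2 W1 x)) (_ : vsproj _ _ = 0) ?linear0 //.
      by apply: (bij_inj g2b); apply: val_inj; rewrite /= g2x !linear0.
    by rewrite -(daddv_pi_sum x) p1 p2 addr0 eqxx.
  - apply/subvP => _ /memv_imgP[x xW ->]; rewrite gE.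
    by rewrite (daddv_pi2_eq0 xW) !linear0 addr0 subvsP.
  apply/subvP => _ /memv_imgP[x xW ->]; rewrite gE.
  by rewrite (daddv_pi1_eq0 xW) !linear0 add0r subvsP.
have restrict (W : {vspace V}) : (g @: W <= W)%VS ->
    exists h : 'End(subvs_of W), bijective h /\ forall x, x \in W ->
      vsval (h (vsproj W x)) = g x.
  move=> gW; pose h : 'End(subvs_of W) := linfun (vsproj W \o g \o vsval).
  have hE x : vsval (h x) = g (vsval x).
    rewrite lfunE /= vsprojK //; apply: (subvP gW); apply: memv_img.
    exact: subvsP.
  have h0 : lker h == 0%VS.
    apply/lker0P => x y /(congr1 vsval); rewrite !hE => /(lker0P g0).
    exact: val_inj.
  exists h; split; first by exists h^-1%VF; [apply: lker0_lfunK | apply: lker0_lfunVK].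
  by move=> x xW; rewrite hE vsprojK.
have [g1 [g1b g1E]] := restrict _ gW1; have [g2 [g2b g2E]] := restrict _ gW2.
exists g1, g2; split=> // x; rewrite g1E ?memv_pi // g2E ?memv_pi //.
by rewrite -linearD daddv_pi_sum.
Qed.

Lemma Levi_daddv_pi g x : Levi W1 W2 g ->
  daddv_pi W1 W2 (g x) = g (daddv_pi W1 W2 x).
Proof.
move=> /LeviP[_ gW1 gW2]; rewrite -{1}(daddv_pi_sum x) !linearD /=.
rewrite daddv_pi_id ?(subvP gW1) ?memv_img ?memv_pi //.
by rewrite [X in _ + X]daddv_pi1_eq0 ?addr0 // (subvP gW2) ?memv_img ?memv_pi.
Qed.

Lemma Levi1 : Levi W1 W2 \1%VF.
Proof.
apply/LeviP; rewrite !lim1g !subvv; split=> //.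
by apply/lker0P => x y; rewrite !lfunE.
Qed.

Lemma Levi_basis g s1 s2 : Levi W1 W2 g -> basis_of W1 s1 -> basis_of W2 s2 ->
  basis_of W1 (map g s1) /\ basis_of W2 (map g s2).
Proof.
move=> /LeviP[g0 gW1 gW2] s1b s2b.
have gb (W : {vspace V}) s : (g @: W <= W)%VS -> basis_of W s -> basis_of W (map g s).
  move=> gW sb; have kW : (W :&: lker g = 0)%VS by rewrite (eqP g0) capv0.
  suff <- : (g @: W)%VS = W by apply: limg_basis_of.
  by apply/eqP; rewrite eqEdim gW -(limg_dim_eq kW) leqnn.
by split; apply: gb.
Qed.

Lemma basis_cat s1 s2 : basis_of W1 s1 -> basis_of W2 s2 ->
  basis_of fullv (s1 ++ s2).
Proof. by move=> s1b s2b; rewrite -W12 cat_basis. Qed.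

(** The linear map sending one adapted basis to the other respects the summands because the bases
    match blockwise. *)
Lemma Levi_transitive s1 s2 t1 t2 :
    basis_of W1 s1 -> basis_of W2 s2 -> basis_of W1 t1 -> basis_of W2 t2 ->
  exists2 g, Levi W1 W2 g & map g (s1 ++ s2) = t1 ++ t2.
Proof.
move=> s1b s2b t1b t2b.
have sb := basis_cat s1b s2b; have tb := basis_cat t1b t2b.
have [h hE] := linear_of_free (s1 ++ s2) (t1 ++ t2).
have size_st (W : {vspace V}) s t : basis_of W s -> basis_of W t -> size t = size s.
  by move=> sW tW; rewrite -(eqP (basis_free sW)) -(eqP (basis_free tW))
    (span_basis sW) (span_basis tW).
pose g := linfun h.
have gE : map g (s1 ++ s2) = t1 ++ t2.
  rewrite -[RHS]hE ?(basis_free sb) // ?(size_st _ _ _ sb tb) //.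
  by apply: eq_map => x; rewrite lfunE.
have [g1E g2E] : map g s1 = t1 /\ map g s2 = t2.
  move/eqP: gE; rewrite map_cat eqseq_cat ?size_map ?(size_st _ _ _ t1b s1b) //.
  by case/andP => /eqP ? /eqP.
exists g => //; apply/LeviP; split.
(* The image contains a basis, so the kernel is zero by rank and nullity. *)
- have := limg_ker_dim g fullv; rewrite -{2}(span_basis sb) limg_span gE.
  by rewrite (span_basis tb) capfv -[RHS]add0n => /addIn/eqP; rewrite dimv_eq0.
- by rewrite -{1}(span_basis s1b) limg_span g1E (span_basis t1b).
- by rewrite -{1}(span_basis s2b) limg_span g2E (span_basis t2b).
Qed.

(** * Frames, the union of the apartments, and orbit invariance *)

Lemma basis_frame (W : {vspace V}) s :
  basis_of W s <-> is_frame W [seq <[x]>%VS | x <- s].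
Proof.
split=> [sb|[sz _ _ sW]].
  have sz : size s = \dim W by rewrite -(eqP (basis_free sb)) (span_basis sb).
  have sW : (\sum_(l <- [seq <[x]> | x <- s]) l)%VS = W.
    by rewrite big_map -span_def (span_basis sb).
  have s1 : all (fun l => \dim l == 1%N) [seq <[x]>%VS | x <- s].
    apply/allP => _ /mapP[x xs ->]; rewrite dim_vline.
    by rewrite (free_not0 (basis_free sb) xs).
  split=> //; first by rewrite size_map.
  (* The sum is direct because the dimensions of the lines add up to [size s], the dimension of
     [W]. *)
  rewrite directvE /= sW -sz -(size_map (fun x => <[x]>%VS)).
  rewrite -sum1_size !big_seq; apply/eqP/eq_bigr => l /(allP s1)/eqP.
  by move->.
rewrite basisEdim -(size_map (fun x => <[x]>%VS)) sz leqnn andbT.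
by rewrite span_def -(big_map (fun x => <[x]>%VS) xpredT id) sW.
Qed.

Lemma AbarP X : Abar v W1 W2 X <-> exists s1 s2,
  [/\ basis_of W1 s1, basis_of W2 s2 &
      X = homothety_class (intspan_seq (s1 ++ s2))].
Proof.
split=> [[ls1 [ls2 [fr1 fr2 [e [eP ->]]]]]|[s1 [s2 [s1b s2b ->]]]]; last first.
  have s0 x := @free_not0 _ _ x _ (basis_free (basis_cat s1b s2b)).
  exists [seq <[x]>%VS | x <- s1], [seq <[x]>%VS | x <- s2].
  split; try exact/basis_frame; rewrite -map_cat.
  exists (fun i => (s1 ++ s2)`_i); split=> [i|].
    have i_s : (i < size (s1 ++ s2))%N by rewrite -(size_map (fun x => <[x]>%VS)).
    by rewrite s0 ?mem_nth // (nth_map 0) // memv_line.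
  by congr homothety_class; apply/esym/intspan_size; rewrite ?size_map.
pose s := [tuple e i | i < size (ls1 ++ ls2)].
have sE (i : 'I_(size (ls1 ++ ls2))) : s`_i = e i.
  by rewrite -tnth_nth tnth_mktuple.
(* A nonzero vector spans its line, so the chosen vectors recover the frame; cutting at [size ls1]
   separates the two summands. *)
have lsE : ls1 ++ ls2 =
    [seq <[x]>%VS | x <- take (size ls1) s] ++
    [seq <[x]>%VS | x <- drop (size ls1) s].
  rewrite -map_cat cat_take_drop.
  apply: (@eq_from_nth _ 0%VS) => [|i i_ls]; first by rewrite size_map size_tuple.
  have [e0 e_l] := eP (Ordinal i_ls).
  rewrite (nth_map 0) ?size_tuple // (sE (Ordinal i_ls)).
  apply/esym/eqP; rewrite eqEdim -memvE e_l dim_vline e0.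
  have : all (fun l : {vspace V} => \dim l == 1%N) (ls1 ++ ls2).
    by case: fr1 fr2 => [_ l1 _ _] [_ l2 _ _]; rewrite all_cat l1.
  by move=> /(all_nthP 0%VS)/(_ _ i_ls)/eqP->.
have /eqP : size ls1 = size [seq <[x]>%VS | x <- take (size ls1) s].
  by rewrite size_map size_takel // size_tuple size_cat leq_addr.
move: lsE => /eqP lsE /eqP sz; move: lsE; rewrite eqseq_cat //.
move=> /andP[/eqP ls1E /eqP ls2E].
exists (take (size ls1) s), (drop (size ls1) s); split.
- by apply/basis_frame; rewrite -ls1E.
- by apply/basis_frame; rewrite -ls2E.
rewrite cat_take_drop; congr homothety_class.
by apply: intspan_size; rewrite ?size_tuple.
Qed.

(** L maps adapted bases to adapted bases and is transitive on them. *)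
Lemma Lorbit_basis s1 s2 : basis_of W1 s1 -> basis_of W2 s2 ->
  Lorbit W1 W2 (homothety_class (intspan_seq (s1 ++ s2))) = Abar v W1 W2.
Proof.
move=> s1b s2b; apply/seteqP; split=> [_ [g gL <-]|X /AbarP].
  have [gs1 gs2] := Levi_basis gL s1b s2b.
  apply/AbarP; exists (map g s1), (map g s2); split=> //.
  by rewrite act_homothety_class image_intspan_seq map_cat.
move=> [t1 [t2 [t1b t2b ->]]].
have [g gL gE] := Levi_transitive s1b s2b t1b t2b; exists g => //.
by rewrite act_homothety_class image_intspan_seq gE.
Qed.

(** The second lattice is the image of the first under [a] times some [g] in L, and [g] commutes
    with the projection, so the criterion [Ann_QP] carries over. *)
Lemma Ann_Lorbit_sub Lam Lam' :
    Lorbit W1 W2 (vertex Lam) = Lorbit W1 W2 (vertex Lam') ->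
  (Ann (Q W1 W2 Lam) `<=` Ann (Q W1 W2 Lam'))%classic.
Proof.
(* The identity lies in L, so the second vertex belongs to its own orbit and hence to the first. *)
move=> orbE r /Ann_QP rL; apply/Ann_QP => y' y'L.
have : Lorbit W1 W2 (vertex Lam) (vertex Lam').
  rewrite orbE; exists \1%VF; first exact: Levi1.
  rewrite act_homothety_class; congr homothety_class; apply/seteqP.
  split=> [_ [x xL <-]|x xL]; first by rewrite lfunE.
  by exists x => //; rewrite lfunE.
move=> [g gL]; rewrite act_homothety_class => vE.
have : vertex Lam' (lat_set Lam') by exact: mem_homothety_class.
rewrite -vE => -[a a0 L'E].
have lat' z : (z : restr V) \in lat_mod Lam' <->
    exists2 y : V, (y : restr V) \in lat_mod Lam & z = a *: g y.
  apply: (@iff_trans _ (lat_set Lam' z)) => //; rewrite L'E; split.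
    by move=> [_ [y yL <-] <-]; exists y.
  by move=> [y yL ->]; exists (g y) => //; exists y.
have [y yL ->] := (lat' y').1 y'L; apply/lat'.
exists (val r *: daddv_pi W1 W2 y); first exact: rL.
by rewrite linearZ /= Levi_daddv_pi // !linearZ /= !scalerA mulrC.
Qed.

Lemma Ann_Lorbit Lam Lam' :
    Lorbit W1 W2 (vertex Lam) = Lorbit W1 W2 (vertex Lam') ->
  Ann (Q W1 W2 Lam) = Ann (Q W1 W2 Lam').
Proof. by move=> E; apply/seteqP; split; apply: Ann_Lorbit_sub. Qed.

Lemma Abar_lattice : exists2 Lam : lattice v V,
  Abar v W1 W2 = Lorbit W1 W2 (vertex Lam) & Ann (Q W1 W2 Lam) 1.
Proof.
have s1b := vbasisP W1; have s2b := vbasisP W2.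
set s1 : seq V := vbasis W1 in s1b; set s2 : seq V := vbasis W2 in s2b.
have [Lam LamE] := basis_lattice (basis_cat s1b s2b).
exists Lam; first by rewrite /vertex LamE Lorbit_basis.
apply/Ann_QP => y yL; rewrite rmorph1 scale1r.
have {yL}[c ->] : intspan_seq (s1 ++ s2) y by rewrite -LamE.
set y' := daddv_pi W1 W2 _; suff : intspan_seq (s1 ++ s2) y' by rewrite -LamE.
rewrite {}/y'.
(* In an adapted basis the projection keeps the coordinates along [W1] and replaces the others by 0,
   so the span is stable under it. *)
exists (fun i : 'I_(size (s1 ++ s2)) => if (i < size s1)%N then c i else 0).
rewrite linear_sum; apply: eq_bigr => i _; rewrite linearZ /= nth_cat.
case: ltnP => [i1|i2].
  by rewrite daddv_pi_id // (basis_mem s1b) // mem_nth.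
rewrite daddv_pi1_eq0 ?scaler0 ?scale0r // (basis_mem s2b) // mem_nth //.
by rewrite ltn_subLR // -size_cat.
Qed.

End LeviOrbits.

(** * The annihilator exponent as an orbital distance *)

Theorem theorem3p5 (F : fieldType) (v : discreteValuation F)
    (varpi : intring v) (V : vectType F) (W1 W2 : {vspace V})
    (Lam : lattice v V) :
  uniformizer varpi -> finite_residue_field varpi ->
  (W1 + W2)%VS = fullv -> directv (W1 + W2) ->
  (1 <= \dim W1)%N -> (\dim W1 <= \dim W2)%N ->
  dA W1 W2 varpi Lam =
    dO W1 W2 varpi (Lorbit W1 W2 (vertex Lam)) (Abar v W1 W2).
Proof.
move=> varpiP _ W12 dW12 _ _.
(* The type of an orbit may be witnessed by another lattice [Lam'']; invariance of the annihilator
   makes the exponent independent of that choice. *)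
have logP_orbit (Lam' : lattice v V) S (alpha : (\dim W1).-tuple nat) :
    S = Lorbit W1 W2 (vertex Lam') -> orbit_type W2 varpi S alpha ->
    logP varpi (Ann (Q W1 W2 Lam')) =
    (\max_(i < \dim W1) tnth alpha i)%N.
  move=> -> [_ [Lam'' [orbE iso]]].
  rewrite (Ann_Lorbit W12 dW12 orbE) (Ann_isomorphic iso).
  by rewrite (Ann_dirsum_resmod varpiP) (logP_idealP varpiP).
have [Lam0 AbarE Ann0] := Abar_lattice v W12 dW12.
(* The annihilator contains 1, so it is the whole ring, that is P^0. *)
have log0 : logP varpi (Ann (Q W1 W2 Lam0)) = 0%N.
  rewrite -(logP_idealP varpiP 0); congr logP.
  apply/seteqP; split=> [a _|a _ x].
    by apply/(mem_idealP_ord varpiP); right.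
  by rewrite -[a]mulr1 -scalerA Ann0 scaler0.
have distE (alpha beta : (\dim W1).-tuple nat) :
    orbit_type W2 varpi (Lorbit W1 W2 (vertex Lam)) alpha ->
    orbit_type W2 varpi (Abar v W1 W2) beta ->
    tuple_dist alpha beta = dA W1 W2 varpi Lam.
  move=> alphaP betaP; rewrite /dA (logP_orbit _ _ _ erefl alphaP).
  (* The maximum of [beta] is 0, so every [beta i] vanishes and the distance reduces to the maximum
     of [alpha]. *)
  have := logP_orbit _ _ _ AbarE betaP; rewrite log0 => /esym/eqP.
  rewrite -leqn0 => /bigmax_leqP beta0; apply: eq_bigr => i _.
  by have := beta0 i isT; rewrite leqn0 => /eqP->; rewrite subr0.
have [alpha [alpha_dom alpha_iso]] := Q_type varpiP W1 W2 Lam.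
have [beta [beta_dom beta_iso]] := Q_type varpiP W1 W2 Lam0.
have alphaP : orbit_type W2 varpi (Lorbit W1 W2 (vertex Lam)) alpha.
  by split=> //; exists Lam.
have betaP : orbit_type W2 varpi (Abar v W1 W2) beta.
  by split=> //; exists Lam0.
(* [xget] returns the common value because a pair of types exists and all such pairs give the same
   distance. *)
apply/esym/xget_unique.
  by exists alpha, beta; split=> //; rewrite distE.
by move=> _ [alpha' [beta' [alphaP' betaP' ->]]]; exact: distE.
Qed.
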